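(* Let $K$ be a field with $\mathrm{char}(K)\neq 2$ and let $\mathfrak{g}$ be a free non-abelian Lie algebra over $K$ of rank at least $3$. Then $R(\mathfrak{g})$ is infinite-dimensional over $K$.
   Context: For a Lie algebra $\mathfrak{g}$ over $K$, let $\mathfrak{g}^{\psi}$ be an isomorphic copy of $\mathfrak{g}$ via $x\mapsto x^{\psi}$, and let $\chi(\mathfrak{g})=\langle \mathfrak{g},\mathfrak{g}^{\psi} \mid [x,x^{\psi}]=0 \text{ for all } x\in\mathfrak{g}\rangle$ (the quotient of the free product of the Lie algebras $\mathfrak{g}$ and $\mathfrak{g}^{\psi}$ by the ideal generated by all $[x,x^{\psi}]$). Let $\alpha:\chi(\mathfrak{g})\to\mathfrak{g}$ be the homomorphism with $\alpha(x)=\alpha(x^{\psi})=x$ for all $x\in\mathfrak{g}$, and $L=L(\mathfrak{g})=\ker(\alpha)$. Define $R(\mathfrak{g})=[\mathfrak{g},[L,\mathfrak{g}^{\psi}]]$, an ideal of $\chi(\mathfrak{g})$, where brackets of subspaces denote linear spans of brackets of their elements. *)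

(* Defs.v *)
From HB Require Import structures.
From mathcomp Require Import all_boot all_order all_algebra generic_quotient.
From mathcomp Require Import boolp classical_sets.

Set Implicit Arguments.
Unset Strict Implicit.
Unset Printing Implicit Defensive.

Import GRing.Theory.
Local Open Scope ring_scope.
Local Open Scope quotient_scope.
Local Open Scope classical_set_scope.

(* The bracket is alternating, not merely antisymmetric, so that this is the
   usual notion in every characteristic. *)
HB.mixin Record Lmodule_isLieAlgebra (K : fieldType) V of GRing.Lmodule K V := {
  lie : V -> V -> V;
  lie_linearl : forall z : V, linear (fun x : V => lie x z);
  lie_linearr : forall z : V, linear (lie z);
  liexx : forall x : V, lie x x = 0;
  lie_jacobi : forall x y z : V,
    lie x (lie y z) + lie y (lie z x) + lie z (lie x y) = 0
}.

#[short(type="lieAlgType")]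
HB.structure Definition LieAlgebra (K : fieldType) :=
  {V of GRing.Lmodule K V & Lmodule_isLieAlgebra K V}.

Notation "[ 'lie' x , y ]" := (lie x y)
  (at level 0, x, y at level 99, format "[ 'lie'  x ,  y ]") : ring_scope.

Definition lie_morphism (K : fieldType) (g h : lieAlgType K) (f : g -> h) :=
  linear f /\ (forall x y : g, f [lie x, y] = [lie f x, f y]).

(* X may be infinite; i is not assumed injective, as this follows. *)
Definition lie_free_on (K : fieldType) (g : lieAlgType K) (X : Type)
    (i : X -> g) : Prop :=
  forall (h : lieAlgType K) (f : X -> h),
    exists F : g -> h,
      [/\ lie_morphism F, forall x, F (i x) = f x
        & forall G : g -> h, lie_morphism G -> (forall x, G (i x) = f x) ->
            forall y, G y = F y].

Definition lie_abelian (K : fieldType) (g : lieAlgType K) : Prop :=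
  forall x y : g, [lie x, y] = 0.

Section Subspaces.
Variables (K : fieldType) (V : lmodType K).

Definition lin_span (A : set V) : set V :=
  [set v | exists (n : nat) (c : 'I_n -> K) (u : 'I_n -> V),
     (forall k, A (u k)) /\ v = \sum_(k < n) c k *: u k].

Definition finite_dimensional (A : set V) : Prop :=
  exists s : seq V, A `<=` lin_span [set v | v \in s].

End Subspaces.

Definition lie_setbracket (K : fieldType) (g : lieAlgType K) (A B : set g) :
    set g :=
  lin_span [set z | exists x y, [/\ A x, B y & z = [lie x, y]]].

(* Lie algebras given by generators and relations: formal expressions in the
   generators, modulo the least congruence containing the given relations and
   the axioms of Lie algebras. *)
Section Presentation.
Variables (K : fieldType) (X : Type).

Inductive lie_term : Type :=
| LGen of X
| LZero
| LAdd of lie_term & lie_term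
| LScale of K & lie_term
| LBracket of lie_term & lie_term.

HB.instance Definition _ := gen_eqMixin lie_term.
HB.instance Definition _ := gen_choiceMixin lie_term.

Variable rel : lie_term -> lie_term -> Prop.

Inductive lie_cong : lie_term -> lie_term -> Prop :=
| lc_rel s t : rel s t -> lie_cong s t
| lc_refl s : lie_cong s s
| lc_sym s t : lie_cong s t -> lie_cong t s
| lc_trans t s u : lie_cong s t -> lie_cong t u -> lie_cong s u
| lc_add s s' t t' : lie_cong s s' -> lie_cong t t' ->
    lie_cong (LAdd s t) (LAdd s' t')
| lc_scale a s s' : lie_cong s s' -> lie_cong (LScale a s) (LScale a s')
| lc_bracket s s' t t' : lie_cong s s' -> lie_cong t t' ->
    lie_cong (LBracket s t) (LBracket s' t')
| lc_addA s t u : lie_cong (LAdd s (LAdd t u)) (LAdd (LAdd s t) u)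
| lc_addC s t : lie_cong (LAdd s t) (LAdd t s)
| lc_add0 s : lie_cong (LAdd LZero s) s
| lc_addN s : lie_cong (LAdd (LScale (- 1) s) s) LZero
| lc_scaleA a b s : lie_cong (LScale a (LScale b s)) (LScale (a * b) s)
| lc_scale1 s : lie_cong (LScale 1 s) s
| lc_scaleDr a s t :
    lie_cong (LScale a (LAdd s t)) (LAdd (LScale a s) (LScale a t))
| lc_scaleDl s a b :
    lie_cong (LScale (a + b) s) (LAdd (LScale a s) (LScale b s))
| lc_bracketl a s t u : lie_cong (LBracket (LAdd (LScale a s) t) u)
    (LAdd (LScale a (LBracket s u)) (LBracket t u))
| lc_bracketr a s t u : lie_cong (LBracket u (LAdd (LScale a s) t))
    (LAdd (LScale a (LBracket u s)) (LBracket u t))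
| lc_bracketxx s : lie_cong (LBracket s s) LZero
| lc_jacobi s t u : lie_cong
    (LAdd (LAdd (LBracket s (LBracket t u)) (LBracket t (LBracket u s)))
          (LBracket u (LBracket s t))) LZero.

Let cong_equiv : equiv_class_of (fun s t => `[< lie_cong s t >]).
Proof.
split=> [s|s t|t s u].
- exact/asboolP/lc_refl.
- by apply/asboolP/asboolP; exact: lc_sym.
- by move=> /asboolP st /asboolP tu; exact/asboolP/(lc_trans st tu).
Qed.

Canonical lie_cong_equiv := EquivRelPack cong_equiv.

Definition lie_pres : Type := {eq_quot lie_cong_equiv}.

HB.instance Definition _ := Choice.on lie_pres.
HB.instance Definition _ := EqQuotient.on lie_pres.

Lemma lie_presE (s t : lie_term) :
  \pi_lie_pres s = \pi_lie_pres t <-> lie_cong s t.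
Proof.
split=> [/eqmodP/asboolP //|st].
by apply/eqmodP/asboolP.
Qed.

Lemma lie_cong_repr (s : lie_term) : lie_cong (repr (\pi_lie_pres s)) s.
Proof. by apply/lie_presE; rewrite reprK. Qed.

Definition pres_add (x y : lie_pres) := \pi_lie_pres (LAdd (repr x) (repr y)).
Definition pres_scale (a : K) (x : lie_pres) :=
  \pi_lie_pres (LScale a (repr x)).
Definition pres_bracket (x y : lie_pres) :=
  \pi_lie_pres (LBracket (repr x) (repr y)).

Lemma pi_add s t :
  pres_add (\pi_lie_pres s) (\pi_lie_pres t) = \pi_lie_pres (LAdd s t).
Proof. by apply/lie_presE/lc_add; exact: lie_cong_repr. Qed.

Lemma pi_scale a s :
  pres_scale a (\pi_lie_pres s) = \pi_lie_pres (LScale a s).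
Proof. by apply/lie_presE/lc_scale; exact: lie_cong_repr. Qed.

Lemma pi_bracket s t :
  pres_bracket (\pi_lie_pres s) (\pi_lie_pres t) = \pi_lie_pres (LBracket s t).
Proof. by apply/lie_presE/lc_bracket; exact: lie_cong_repr. Qed.

Let addA : associative pres_add.
Proof.
elim/quotW=> s; elim/quotW=> t; elim/quotW=> u.
by rewrite (pi_add t u) (pi_add s t) !pi_add; apply/lie_presE/lc_addA.
Qed.

Let addC : commutative pres_add.
Proof.
by elim/quotW=> s; elim/quotW=> t; rewrite !pi_add; apply/lie_presE/lc_addC.
Qed.

Let add0 : left_id (\pi_lie_pres LZero) pres_add.
Proof. by elim/quotW=> s; rewrite pi_add; apply/lie_presE/lc_add0. Qed.

Let addN : left_inverse (\pi_lie_pres LZero) (pres_scale (- 1)) pres_add.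
Proof.
by elim/quotW=> s; rewrite (pi_scale _ s) pi_add; apply/lie_presE/lc_addN.
Qed.

HB.instance Definition _ := GRing.isZmodule.Build lie_pres addA addC add0 addN.

Let scaleA a b x : pres_scale a (pres_scale b x) = pres_scale (a * b) x.
Proof.
elim/quotW: x => s; rewrite (pi_scale b s) !pi_scale.
by apply/lie_presE/lc_scaleA.
Qed.

Let scale1 : left_id 1 pres_scale.
Proof. by elim/quotW=> s; rewrite pi_scale; apply/lie_presE/lc_scale1. Qed.

Let scaleDr : right_distributive pres_scale +%R.
Proof.
move=> a; elim/quotW=> s; elim/quotW=> t.
change (pres_scale a (pres_add (\pi_lie_pres s) (\pi_lie_pres t)) =
  pres_add (pres_scale a (\pi_lie_pres s)) (pres_scale a (\pi_lie_pres t))).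
rewrite (pi_add s t) (pi_scale a s) (pi_scale a t) pi_scale pi_add.
by apply/lie_presE/lc_scaleDr.
Qed.

Let scaleDl x : {morph pres_scale^~ x : a b / a + b}.
Proof.
elim/quotW: x => s a b.
change (pres_scale (a + b) (\pi_lie_pres s) =
  pres_add (pres_scale a (\pi_lie_pres s)) (pres_scale b (\pi_lie_pres s))).
rewrite (pi_scale a s) (pi_scale b s) pi_scale pi_add.
by apply/lie_presE/lc_scaleDl.
Qed.

HB.instance Definition _ :=
  GRing.Zmodule_isLmodule.Build K lie_pres scaleA scale1 scaleDr scaleDl.

Lemma pi_lie_add s t :
  \pi_lie_pres (LAdd s t) = (\pi_lie_pres s : lie_pres) + \pi_lie_pres t.
Proof. by rewrite -pi_add. Qed.

Lemma pi_lie_scale a s :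
  \pi_lie_pres (LScale a s) = a *: (\pi_lie_pres s : lie_pres).
Proof. by rewrite -pi_scale. Qed.

Let bracketl z : linear (fun x : lie_pres => pres_bracket x z).
Proof.
move=> a; elim/quotW: z => u; elim/quotW=> s; elim/quotW=> t.
rewrite -pi_lie_scale -pi_lie_add !pi_bracket -pi_lie_scale -pi_lie_add.
by apply/lie_presE/lc_bracketl.
Qed.

Let bracketr z : linear (pres_bracket z).
Proof.
move=> a; elim/quotW: z => u; elim/quotW=> s; elim/quotW=> t.
rewrite -pi_lie_scale -pi_lie_add !pi_bracket -pi_lie_scale -pi_lie_add.
by apply/lie_presE/lc_bracketr.
Qed.

Let bracketxx x : pres_bracket x x = 0.
Proof.
by elim/quotW: x => s; rewrite pi_bracket; apply/lie_presE/lc_bracketxx.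
Qed.

Let bracket_jacobi x y z :
  pres_bracket x (pres_bracket y z) + pres_bracket y (pres_bracket z x)
    + pres_bracket z (pres_bracket x y) = 0.
Proof.
elim/quotW: x => s; elim/quotW: y => t; elim/quotW: z => u.
rewrite (pi_bracket t u) (pi_bracket u s) (pi_bracket s t) !pi_bracket.
by rewrite -!pi_lie_add; apply/lie_presE/lc_jacobi.
Qed.

HB.instance Definition _ := Lmodule_isLieAlgebra.Build K lie_pres
  bracketl bracketr bracketxx bracket_jacobi.

Lemma pi_lie_bracket s t :
  \pi_lie_pres (LBracket s t) =
  [lie (\pi_lie_pres s : lie_pres), (\pi_lie_pres t : lie_pres)].
Proof. by rewrite -pi_bracket. Qed.

Definition lie_gen (x : X) : lie_pres := \pi_lie_pres (LGen x).

Section Lift.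
Variables (h : lieAlgType K) (f : X -> h).

Fixpoint lie_eval (t : lie_term) : h :=
  match t with
  | LGen x => f x
  | LZero => 0
  | LAdd s t => lie_eval s + lie_eval t
  | LScale a s => a *: lie_eval s
  | LBracket s t => [lie lie_eval s, lie_eval t]
  end.

Definition lie_lift (z : lie_pres) : h := lie_eval (repr z).

Hypothesis f_rel : forall s t, rel s t -> lie_eval s = lie_eval t.

Lemma lie_eval_cong s t : lie_cong s t -> lie_eval s = lie_eval t.
Proof.
elim=> /=.
- exact: f_rel.
- by [].
- by move=> ? ? _ ->.
- by move=> ? ? ? _ -> _ ->.
- by move=> ? ? ? ? _ -> _ ->.
- by move=> ? ? ? _ ->.
- by move=> ? ? ? ? _ -> _ ->.
- by move=> *; rewrite addrA.
- by move=> *; rewrite addrC.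
- by move=> *; rewrite add0r.
- by move=> *; rewrite scaleN1r addNr.
- by move=> *; rewrite scalerA.
- by move=> *; rewrite scale1r.
- by move=> *; rewrite scalerDr.
- by move=> *; rewrite scalerDl.
- by move=> *; rewrite lie_linearl.
- by move=> *; rewrite lie_linearr.
- by move=> *; rewrite liexx.
- by move=> *; rewrite lie_jacobi.
Qed.

Lemma lie_lift_pi s : lie_lift (\pi_lie_pres s) = lie_eval s.
Proof. exact/lie_eval_cong/lie_cong_repr. Qed.

Lemma lie_lift_gen x : lie_lift (lie_gen x) = f x.
Proof. exact: lie_lift_pi. Qed.

Lemma lie_lift_morphism : lie_morphism lie_lift.
Proof.
split=> [a|]; elim/quotW=> s; elim/quotW=> t.
  by rewrite -pi_lie_scale -pi_lie_add !lie_lift_pi.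
by rewrite -pi_lie_bracket !lie_lift_pi.
Qed.

End Lift.

Lemma lie_pres_ext (h : lieAlgType K) (F G : lie_pres -> h) :
  lie_morphism F -> lie_morphism G ->
  (forall x, F (lie_gen x) = G (lie_gen x)) -> F =1 G.
Proof.
have mor0 (H : lie_pres -> h) : linear H -> H 0 = 0.
  by move=> Hl; have := Hl (-1) 0 0; rewrite scaler0 addr0 scaleN1r addNr.
have morZ (H : lie_pres -> h) : linear H -> forall a x, H (a *: x) = a *: H x.
  by move=> Hl a x; have := Hl a x 0; rewrite !addr0 (mor0 _ Hl) addr0.
move=> [Fl Fb] [Gl Gb] FG; elim/quotW.
elim=> [x||s IHs t IHt|a s IHs|s IHs t IHt].
- exact: FG.
- by rewrite -[\pi_lie_pres LZero]/(0 : lie_pres) !mor0.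
- rewrite pi_lie_add -[\pi_lie_pres s as X in X + _]scale1r Fl Gl.
  by rewrite IHs IHt.
- by rewrite pi_lie_scale !morZ // IHs.
- by rewrite pi_lie_bracket Fb Gb IHs IHt.
Qed.

End Presentation.

Arguments LZero {K X}.

Lemma lie_pres_free (K : fieldType) (X : Type) :
  lie_free_on (lie_gen (fun _ _ : lie_term K X => False)).
Proof.
move=> h f; pose F := lie_lift (rel := fun _ _ : lie_term K X => False) f.
have frel (s t : lie_term K X) : False -> lie_eval f s = lie_eval f t by [].
have Fmor : lie_morphism F by exact: lie_lift_morphism frel.
have Fgen x : F (lie_gen _ x) = f x by exact: lie_lift_gen frel x.
exists F; split=> // G Gmor Ggen; apply: lie_pres_ext => // x.
by rewrite Ggen Fgen.
Qed.

Section Chi.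
Variables (K : fieldType) (g : lieAlgType K).

(* The generators are inl x = x and inr x = x^psi, for x in g.  The first four
   relations present the free product of g and its copy g^psi. *)
Inductive chi_rel : lie_term K (g + g) -> lie_term K (g + g) -> Prop :=
| chi_lin a x y : chi_rel (LGen K (inl (a *: x + y)))
    (LAdd (LScale a (LGen K (inl x))) (LGen K (inl y)))
| chi_bracket x y : chi_rel (LGen K (inl [lie x, y]))
    (LBracket (LGen K (inl x)) (LGen K (inl y)))
| chi_linpsi a x y : chi_rel (LGen K (inr (a *: x + y)))
    (LAdd (LScale a (LGen K (inr x))) (LGen K (inr y)))
| chi_bracketpsi x y : chi_rel (LGen K (inr [lie x, y]))
    (LBracket (LGen K (inr x)) (LGen K (inr y)))
| chi_comm x : chi_rel (LBracket (LGen K (inl x)) (LGen K (inr x))) LZero.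

Definition chi : lieAlgType K := lie_pres chi_rel.

Definition chi_in (x : g) : chi := lie_gen chi_rel (inl x).
Definition chi_psi (x : g) : chi := lie_gen chi_rel (inr x).

Definition chi_alpha : chi -> g :=
  lie_lift (fun x : g + g => match x with inl y => y | inr y => y end).

Lemma chi_alpha_rel s t : chi_rel s t ->
  lie_eval (fun x : g + g => match x with inl y => y | inr y => y end) s =
  lie_eval (fun x : g + g => match x with inl y => y | inr y => y end) t.
Proof. by case=> //= x; rewrite liexx. Qed.

Lemma chi_alpha_morphism : lie_morphism chi_alpha.
Proof. exact: lie_lift_morphism chi_alpha_rel. Qed.

Lemma chi_alpha_in x : chi_alpha (chi_in x) = x.
Proof. exact: (lie_lift_gen chi_alpha_rel). Qed.

Lemma chi_alpha_psi x : chi_alpha (chi_psi x) = x.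
Proof. exact: (lie_lift_gen chi_alpha_rel). Qed.

Definition chi_L : set chi := [set z | chi_alpha z = 0].

Definition chi_R : set chi :=
  lie_setbracket (range chi_in) (lie_setbracket chi_L (range chi_psi)).

End Chi.

Arguments chi_L {K} g.
Arguments chi_R {K} g.

(* Main.v *)
Require Import Defs.
From HB Require Import structures.
From mathcomp Require Import all_boot all_order all_algebra.
From mathcomp Require Import boolp classical_sets.
From mathcomp Require Import ring.

Set Implicit Arguments.
Unset Strict Implicit.
Unset Printing Implicit Defensive.

Import GRing.Theory.
Local Open Scope ring_scope.

(** The idea is to map [chi g] to a Lie algebra in which the image of [R(g)] is
    visibly infinite-dimensional.  Let [S = K[t]], and let [aff] be the Lie
    algebra on [S^3] in which the third basis vector acts as the identity on
    the abelian ideal spanned by the other two.  Two copies of [aff] are glued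
    along a line [S w]: the bracket of an element of the first copy with an
    element of the second is [det (a, b) w], where [a] and [b] are their
    components in [S^2], and each copy acts on [w] through its third
    coordinate.  This is a Lie algebra, [aff_double], and since the determinant
    is alternating, each [x] in the first copy commutes with the same [x] in
    the second.  Hence a morphism [p : g -> aff] induces a morphism
    [chi g -> aff_double] ([chi_to_double]).

    On certain elements of [R(g)] this morphism is a 3x3 determinant:
    [ [x, [y - y^psi, z^psi]] ] goes to [det (p x, p y, p z) w].
    As [g] is free of rank at least 3, [p] can send three generators to
    [t e3], [e1] and [e2].  The iterated brackets of the first with the third
    are then sent to [t^k e2], so that the image of [R(g)] contains
    [t^(k+1) w] for every [k] ([chi_R_powers]), and polynomials of unbounded
    degree cannot come from a finite-dimensional space. *)

Section LieBasics.
Variables (K : fieldType) (h k : lieAlgType K).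

Lemma lie0r (x : h) : [lie x, 0] = 0.
Proof.
by have := lie_linearr x (-1) 0 0; rewrite scaler0 addr0 scaleN1r addNr.
Qed.

Lemma lie0l (x : h) : [lie 0, x] = 0.
Proof.
by have := lie_linearl x (-1) 0 0; rewrite scaler0 addr0 scaleN1r addNr.
Qed.

Variable F : h -> k.
Hypothesis F_mor : lie_morphism F.

Lemma lie_morphismB x y : F (x - y) = F x - F y.
Proof.
by have := F_mor.1 (-1) y x; rewrite !scaleN1r ![- _ + _]addrC.
Qed.

Lemma lie_morphism0 : F 0 = 0.
Proof. by rewrite -[0 in LHS](subrr 0) lie_morphismB subrr. Qed.

Lemma lie_morphism_sum n (c : 'I_n -> K) (u : 'I_n -> h) :
  F (\sum_(j < n) c j *: u j) = \sum_(j < n) c j *: F (u j).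
Proof.
elim: n c u => [|n IHn] c u; first by rewrite !big_ord0 lie_morphism0.
by rewrite !big_ord_recl F_mor.1 IHn.
Qed.

End LieBasics.

Lemma sub_lin_span (K : fieldType) (V : lmodType K) (A : set V) (v : V) :
  A v -> lin_span A v.
Proof.
move=> Av; exists 1, (fun=> 1), (fun=> v); split=> //.
by rewrite big_ord1 scale1r.
Qed.

Section Target.
Variables (K : fieldType) (S : comAlgType K).

(** The ring tactic handles products but not the action of [K] on [S]; naming the
    scalar [b] abstractly keeps the rewriting from looping on [a%:A = a *: 1]. *)
Let scale_mull (a : K) : exists b : S, forall x : S, a *: x = b * x.
Proof. by exists a%:A => x; rewrite mulr_algl. Qed.

Definition aff : Type := (S * S * S)%type.
HB.instance Definition _ := GRing.Lmodule.on aff.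

Definition aff_bracket (p q : aff) : aff :=
  (p.2 * q.1.1 - q.2 * p.1.1, p.2 * q.1.2 - q.2 * p.1.2, 0).

Let aff_linearl z : linear (fun x : aff => aff_bracket x z).
Proof.
move: z => [[z1 z2] z3] a [[x1 x2] x3] [[y1 y2] y3].
have [b b_scale] := scale_mull a.
rewrite /aff_bracket /=; congr (_, _, _) => /=; last by rewrite scaler0 addr0.
all: by rewrite !b_scale; ring.
Qed.

Let aff_linearr z : linear (aff_bracket z).
Proof.
move: z => [[z1 z2] z3] a [[x1 x2] x3] [[y1 y2] y3].
have [b b_scale] := scale_mull a.
rewrite /aff_bracket /=; congr (_, _, _) => /=; last by rewrite scaler0 addr0.
all: by rewrite !b_scale; ring.
Qed.

Let aff_xx x : aff_bracket x x = 0.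
Proof. by rewrite /aff_bracket !subrr. Qed.

Let aff_jacobi x y z :
  aff_bracket x (aff_bracket y z) + aff_bracket y (aff_bracket z x)
    + aff_bracket z (aff_bracket x y) = 0.
Proof.
move: x y z => [[x1 x2] x3] [[y1 y2] y3] [[z1 z2] z3].
by rewrite /aff_bracket /=; congr (_, _, _) => /=; ring.
Qed.

HB.instance Definition _ := Lmodule_isLieAlgebra.Build K aff
  aff_linearl aff_linearr aff_xx aff_jacobi.

Definition aff_det (p q : aff) : S := p.1.1 * q.1.2 - p.1.2 * q.1.1.

(** The line [S w] is the last factor.  Its generator [w] has weight 1 under the
    third coordinate of each copy of [aff]. *)
Definition aff_double : Type := (aff * aff * S)%type.
HB.instance Definition _ := GRing.Lmodule.on aff_double.

Definition double_bracket (m n : aff_double) : aff_double :=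
  ([lie m.1.1, n.1.1], [lie m.1.2, n.1.2],
   aff_det m.1.1 n.1.2 - aff_det n.1.1 m.1.2
     + (m.1.1.2 + m.1.2.2) * n.2 - (n.1.1.2 + n.1.2.2) * m.2).

Let double_linearl z : linear (fun x : aff_double => double_bracket x z).
Proof.
move: z => [[p q] w] a [[p' q'] w'] [[p'' q''] w''].
have [b b_scale] := scale_mull a.
rewrite /double_bracket /=; congr (_, _, _) => /=; try exact: lie_linearl.
by rewrite /aff_det /= !b_scale; ring.
Qed.

Let double_linearr z : linear (double_bracket z).
Proof.
move: z => [[p q] w] a [[p' q'] w'] [[p'' q''] w''].
have [b b_scale] := scale_mull a.
rewrite /double_bracket /=; congr (_, _, _) => /=; try exact: lie_linearr.
by rewrite /aff_det /= !b_scale; ring.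
Qed.

Let double_xx x : double_bracket x x = 0.
Proof. by rewrite /double_bracket !liexx subrr add0r subrr. Qed.

(** On the line [S w], the identity says that the determinant pairing of the two
    copies is equivariant: the third basis vector of a copy acts as the identity
    on one argument of the determinant and as zero on the other, so it
    multiplies the pairing by 1, which is its weight on [w]. *)
Let double_jacobi x y z :
  double_bracket x (double_bracket y z) + double_bracket y (double_bracket z x)
    + double_bracket z (double_bracket x y) = 0.
Proof.
move: x y z => [[p q] w] [[p' q'] w'] [[p'' q''] w''].
rewrite /double_bracket /=; congr (_, _, _) => /=; try exact: lie_jacobi.
by rewrite /aff_det /=; ring.
Qed.

HB.instance Definition _ := Lmodule_isLieAlgebra.Build K aff_double
  double_linearl double_linearr double_xx double_jacobi.

Variables (g : lieAlgType K) (p : g -> aff).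
Hypothesis p_mor : lie_morphism p.

Let double_gen (x : g + g) : aff_double :=
  match x with inl y => (p y, 0, 0) | inr y => (0, p y, 0) end.

Definition chi_to_double : chi g -> aff_double := lie_lift double_gen.

(** The relation [ [x, x^psi] = 0 ] holds because the determinant, by which the
    two copies of [aff] fail to commute, is alternating. *)
Let double_gen_rel s t : chi_rel s t ->
  lie_eval double_gen s = lie_eval double_gen t.
Proof.
case=> [a x y|x y|a x y|x y|x] /=.
- rewrite p_mor.1; congr (_, _, _) => /=; by rewrite ?scaler0 ?addr0.
- rewrite p_mor.2; congr (_, _, _) => /=; first by rewrite lie0r.
  by rewrite /aff_det /=; ring.
- rewrite p_mor.1; congr (_, _, _) => /=; by rewrite ?scaler0 ?addr0.
- rewrite p_mor.2; congr (_, _, _) => /=; first by rewrite lie0r.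
  by rewrite /aff_det /=; ring.
- congr (_, _, _) => /=; rewrite ?lie0r ?lie0l //.
  by rewrite /aff_det /=; ring.
Qed.

Lemma chi_to_double_morphism : lie_morphism chi_to_double.
Proof. exact: lie_lift_morphism double_gen_rel. Qed.

Lemma chi_to_double_in x : chi_to_double (chi_in x) = (p x, 0, 0).
Proof. exact: (lie_lift_gen double_gen_rel). Qed.

Lemma chi_to_double_psi x : chi_to_double (chi_psi x) = (0, p x, 0).
Proof. exact: (lie_lift_gen double_gen_rel). Qed.

(** The right-hand side is the expansion along the last column of the 3x3
    determinant with rows [p x], [p y], [p z]; in particular it vanishes when
    the image of [p] has rank less than 3 over [S]. *)
Lemma chi_to_double_R x y z :
  (chi_to_double
     [lie chi_in x, [lie chi_in y - chi_psi y, chi_psi z]]).2 =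
  (p x).2 * aff_det (p y) (p z) - (p y).2 * aff_det (p x) (p z)
    + (p z).2 * aff_det (p x) (p y).
Proof.
rewrite !chi_to_double_morphism.2 (lie_morphismB chi_to_double_morphism).
rewrite chi_to_double_in !chi_to_double_psi chi_to_double_in.
by rewrite /lie /= /double_bracket /= /aff_det /lie /= /aff_bracket /=; ring.
Qed.

End Target.

(** The ideal [L] enters through its elements [y - y^psi], on which [chi_alpha]
    visibly vanishes. *)
Lemma chi_R_gen (K : fieldType) (g : lieAlgType K) (x y z : g) :
  chi_R g [lie chi_in x, [lie chi_in y - chi_psi y, chi_psi z]].
Proof.
apply: sub_lin_span; exists (chi_in x), [lie chi_in y - chi_psi y, chi_psi z].
split=> //.
apply: sub_lin_span; exists (chi_in y - chi_psi y), (chi_psi z).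
split=> //.
rewrite /chi_L /= (lie_morphismB (chi_alpha_morphism g)).
by rewrite chi_alpha_in chi_alpha_psi subrr.
Qed.

(** Bracketing with [x] multiplies [p z] by ['X], so replacing [z] by its [n]-th
    iterated bracket with [x] turns the determinant ['X] into
    ['X^(n.+1)]. *)
Lemma chi_R_powers (K : fieldType) (g : lieAlgType K)
    (p : g -> aff {poly K}) (x y z : g) : lie_morphism p ->
    p x = (0, 0, 'X) -> p y = (1, 0, 0) -> p z = (0, 1, 0) ->
  forall n, exists2 r, chi_R g r & (chi_to_double p r).2 = 'X^(n.+1).
Proof.
move=> p_mor px py pz n.
have pzn : p (iter n (lie x) z) = (0, 'X^n, 0).
  elim: n => [|n IHn]; first by rewrite pz expr0.
  rewrite iterS p_mor.2 px IHn; congr (_, _, _) => /=; first by ring.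
  by rewrite mulr0 subr0 exprS.
exists [lie chi_in x, [lie chi_in y - chi_psi y, chi_psi (iter n (lie x) z)]].
  exact: chi_R_gen.
rewrite chi_to_double_R // px py pzn /aff_det /= exprS; ring.
Qed.

Theorem theorem1p4 (K : fieldType) (char_neq2 : 2%N \notin [pchar K])
  (g : lieAlgType K) (g_nonabelian : ~ lie_abelian g)
  (X : Type) (i : X -> g) (g_free : lie_free_on i)
  (rank_ge3 : exists x y z : X, [/\ x <> y, x <> z & y <> z]) :
  ~ finite_dimensional (chi_R g).
Proof.
case: rank_ge3 => x [y [z [xy xz yz]]].
pose f (v : X) : aff {poly K} :=
  if `[< v = x >] then (0, 0, 'X)
  else if `[< v = y >] then (1, 0, 0)
  else if `[< v = z >] then (0, 1, 0) else 0.
have [p [p_mor pi _]] := g_free _ f.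
have px : p (i x) = (0, 0, 'X) by rewrite pi /f asboolT.
have py : p (i y) = (1, 0, 0).
  by rewrite pi /f asboolF ?asboolT // => /esym.
have pz : p (i z) = (0, 1, 0).
  rewrite pi /f (asboolF (P := z = x)); last by move=> /esym.
  by rewrite asboolF ?asboolT // => /esym.
case=> s span_s.
have Fmor := chi_to_double_morphism p_mor.
(* A spanning list bounds the degree of every image in the last factor. *)
pose N := \max_(v <- s) size (chi_to_double p v).2.
have [r /span_s [n [c [u [us ->]]]]] := chi_R_powers p_mor px py pz N.
rewrite (lie_morphism_sum Fmor) => /(congr1 (fun q : {poly K} => size q)).
rewrite size_polyXn (raddf_sum (@snd _ _)) /= => sizeE.
have : (N.+2 <= N)%N; last by rewrite ltnNge leqnSn.
rewrite -sizeE; apply: leq_trans (size_sum _ _ _) _.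
apply/bigmax_leqP => j _; apply: leq_trans (size_scale_leq _ _) _.
exact: (@leq_bigmax_seq _ s xpredT
  (fun v => size (chi_to_double p v).2) (u j) (us j) isT).
Qed.
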